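(* Suppose that: (i) for each $(\pi,V)\in\mathbb{S}\times\mathbb{R}^d$ there exists a unique Nash minimizer $P(\pi,V)$ of $e(\pi,\cdot,V)$; (ii) each cost $c_{ij}(\pi,P)=c_{ij}(\pi,P_{i\cdot})$ depends only on $\pi$ and on the $i$-th row $P_{i\cdot}$ of $P$; (iii) there exists a constant $\gamma>0$ such that $$\tilde\pi\cdot(\mathcal{G}_{\tilde\pi}(V)-\mathcal{G}_\pi(V))+\pi\cdot(\mathcal{G}_\pi(\tilde V)-\mathcal{G}_{\tilde\pi}(\tilde V))\ge\gamma\|\pi-\tilde\pi\|^2$$ for any $V,\tilde V\in\mathbb{R}^d$ and all $\pi,\tilde\pi\in\mathbb{S}$. Let $(\pi^k,V^k)\in\mathbb{S}\times\mathbb{R}^d$, $k=1,2$, be stationary solutions: $$\mathcal{K}_{V^k}(\pi^k)=\pi^k,\qquad \mathcal{G}_{\pi^k}(V^k)=\lambda^k+V^k,$$ where $\lambda^k\in\mathbb{R}$ are constants. Then $\pi^1=\pi^2$.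
   Context: Let $d>1$ be an integer and $\mathbb{S}=\{(q_1,\dots,q_d): q_j\ge 0\ \forall j,\ \sum_{j=1}^d q_j=1\}$. The set of $d\times d$ (row-)stochastic (transition) matrices is identified with $\mathbb{S}^d$. Given transition costs $c_{ij}(\pi,P)$, $1\le i,j\le d$ (functions of $\pi\in\mathbb{S}$, $P\in\mathbb{S}^d$), define $e_i(\pi,P,V)=\sum_j \left(c_{ij}(\pi,P)P_{ij}+V_jP_{ij}\right)$ for $V\in\mathbb{R}^d$. For $P\in\mathbb{S}^d$, $q\in\mathbb{S}$, $\mathcal{P}(P,q,i)$ is the stochastic matrix obtained from $P$ by replacing its $i$-th row by $q$. A matrix $P\in\mathbb{S}^d$ is a Nash minimizer of $e(\pi,\cdot,V)$ if for each $i$ and any $q\in\mathbb{S}$, $e_i(\pi,P,V)\le e_i(\pi,\mathcal{P}(P,q,i),V)$. When a unique Nash minimizer $P(\pi,V)$ exists for all $(\pi,V)$, define $\mathcal{G}_\pi(V)_i=e_i(\pi,P(\pi,V),V)$ and $\mathcal{K}_V(\pi)=\pi P(\pi,V)$ (row vector times matrix). Adding a scalar to a vector means adding it to every component; $\|\cdot\|$ is a fixed norm on $\mathbb{R}^d$. *)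

(* Defs.v *)
From mathcomp Require Import all_boot all_order all_algebra.
From mathcomp Require Import boolp classical_sets reals.
Set Implicit Arguments.
Unset Strict Implicit.
Unset Printing Implicit Defensive.
Import Order.TTheory GRing.Theory Num.Theory.
Local Open Scope ring_scope.

(* All vectors of R^d, including V and G_pi(V), are row
   vectors. *)

(* An arbitrary norm on R^d; the canonical norm `|_| on 'rV[R]_d is only the
   max norm. The axioms are those of the factory Lmodule_isNormed. *)
Definition is_norm (R : realType) (d : nat) (nrm : 'rV[R]_d -> R) : Prop :=
  [/\ forall x y, nrm (x + y) <= nrm x + nrm y,
      forall (a : R) x, nrm (a *: x) = `|a| * nrm x
    & forall x, nrm x = 0 -> x = 0].

Definition dotv (R : realType) (d : nat) (u v : 'rV[R]_d) : R :=
  \sum_j u 0 j * v 0 j.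

Definition simplex (R : realType) (d : nat) (q : 'rV[R]_d) : Prop :=
  (forall j, 0 <= q 0 j) /\ \sum_j q 0 j = 1.

Definition stochastic (R : realType) (d : nat) (P : 'M[R]_d) : Prop :=
  forall i, simplex (row i P).

(* Costs c i j pi P. They are total functions for convenience: only their
   values at pi in the simplex and P stochastic are ever meaningful, and every
   hypothesis about them is restricted to such arguments. *)
Definition costs (R : realType) (d : nat) : Type :=
  'I_d -> 'I_d -> 'rV[R]_d -> 'M[R]_d -> R.

Definition row_dependent (R : realType) (d : nat) (c : costs R d) : Prop :=
  forall (i j : 'I_d) (pi : 'rV[R]_d) (P Q : 'M[R]_d),
    simplex pi -> stochastic P -> stochastic Q ->
    row i P = row i Q -> c i j pi P = c i j pi Q.

Definition ecost (R : realType) (d : nat) (c : costs R d)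
    (pi : 'rV[R]_d) (P : 'M[R]_d) (V : 'rV[R]_d) (i : 'I_d) : R :=
  \sum_j (c i j pi P * P i j + V 0 j * P i j).

Definition replace_row (R : realType) (d : nat)
    (P : 'M[R]_d) (q : 'rV[R]_d) (i : 'I_d) : 'M[R]_d :=
  \matrix_(k, l) (if k == i then q 0 l else P k l).

Definition nash_minimizer (R : realType) (d : nat) (c : costs R d)
    (pi V : 'rV[R]_d) (P : 'M[R]_d) : Prop :=
  stochastic P /\
  forall (i : 'I_d) (q : 'rV[R]_d), simplex q ->
    ecost c pi P V i <= ecost c pi (replace_row P q i) V i.

(* P(pi, V): the Nash minimizer when there is a unique one; 0 (a junk value)
   when there is none. *)
Definition nash (R : realType) (d : nat) (c : costs R d)
    (pi V : 'rV[R]_d) : 'M[R]_d :=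
  xget 0 (nash_minimizer c pi V : set 'M[R]_d).

Definition Gmap (R : realType) (d : nat) (c : costs R d)
    (pi V : 'rV[R]_d) : 'rV[R]_d :=
  \row_i ecost c pi (nash c pi V) V i.

Definition Kmap (R : realType) (d : nat) (c : costs R d)
    (V pi : 'rV[R]_d) : 'rV[R]_d :=
  pi *m nash c pi V.

(* Main.v *)
(* Row dependence makes a Nash minimizer minimize each [ecost c pi P V i] over
   all stochastic P, so G_pi(V') <= G_pi(V) + P(pi, V) (V' - V) componentwise.
   At a stationary solution (pi, V, lambda), pairing with pi = pi P(pi, V) gives
   pi . G_pi(V') <= lambda + pi . V' for every V'. Using this for (pi1, V' = V2)
   and (pi2, V' = V1), the monotonicity form is <= 0, whence pi1 = pi2. *)
Require Import Defs.
From mathcomp Require Import all_boot all_order all_algebra.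
From mathcomp Require Import boolp classical_sets reals.
From mathcomp Require Import lra.
Import Order.TTheory GRing.Theory Num.Theory.
Local Open Scope ring_scope.

Lemma dotvDr (R : realType) (d : nat) (u v w : 'rV[R]_d) :
  dotv u (v + w) = dotv u v + dotv u w.
Proof. by rewrite /dotv -big_split; apply: eq_bigr => j _; rewrite mxE mulrDr. Qed.

Lemma dotvBr (R : realType) (d : nat) (u v w : 'rV[R]_d) :
  dotv u (v - w) = dotv u v - dotv u w.
Proof. by rewrite -[in RHS](subrK w v) (dotvDr R d u (v - w) w) addrK. Qed.

Lemma dotv_simplex_const (R : realType) (d : nat) (q : 'rV[R]_d) (a : R) :
  simplex q -> dotv q (const_mx a) = a.
Proof.
case=> _ q1; rewrite /dotv -[RHS]mul1r -q1 mulr_suml.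
by apply: eq_bigr => j _; rewrite mxE.
Qed.

Lemma dotv_simplex_le (R : realType) (d : nat) (q u v : 'rV[R]_d) :
  simplex q -> (forall i, u 0 i <= v 0 i) -> dotv q u <= dotv q v.
Proof. by case=> q0 _ leuv; apply: ler_sum => i _; apply: ler_wpM2l. Qed.

(** Transposition moves the matrix from the value side to the distribution side, where the
    invariance of [pi] can absorb it. *)
Lemma dotv_mulmx (R : realType) (d : nat) (u v : 'rV[R]_d) (P : 'M[R]_d) :
  dotv u (v *m P^T) = dotv (u *m P) v.
Proof.
have dotvE (x y : 'rV[R]_d) : dotv x y = (x *m y^T) 0 0.
  by rewrite mxE; apply: eq_bigr => j _; rewrite mxE.
by rewrite !dotvE trmx_mul trmxK mulmxA.
Qed.

Lemma replace_row_stochastic (R : realType) (d : nat) (P : 'M[R]_d)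
    (q : 'rV[R]_d) (i : 'I_d) :
  stochastic P -> simplex q -> stochastic (replace_row P q i).
Proof.
move=> sP sq k.
suff -> : row k (replace_row P q i) = if k == i then q else row k P.
  by case: ifP.
by apply/rowP => j; rewrite !mxE; case: ifP => // _; rewrite mxE.
Qed.

Lemma row_replace_row (R : realType) (d : nat) (P : 'M[R]_d)
    (q : 'rV[R]_d) (i : 'I_d) :
  row i (replace_row P q i) = q.
Proof. by apply/rowP => j; rewrite !mxE eqxx. Qed.

Lemma ecost_row (R : realType) (d : nat) (c : costs R d)
    (pi V : 'rV[R]_d) (P Q : 'M[R]_d) (i : 'I_d) :
  row_dependent c -> simplex pi -> stochastic P -> stochastic Q ->
  row i P = row i Q -> ecost c pi P V i = ecost c pi Q V i.
Proof.
move=> rowc spi sP sQ PQ; apply: eq_bigr => j _.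
rewrite (rowc i j pi P Q) //.
by have /rowP/(_ j) := PQ; rewrite !mxE => ->.
Qed.

(** For frozen [P] the cost is affine in the value vector. Since vectors are rows, the pairing of
    [W] with row [i] of [P] appears as an entry of [W *m P^T]. *)
Lemma ecostD (R : realType) (d : nat) (c : costs R d)
    (pi V W : 'rV[R]_d) (P : 'M[R]_d) (i : 'I_d) :
  ecost c pi P (V + W) i = ecost c pi P V i + (W *m P^T) 0 i.
Proof.
rewrite /ecost mxE -big_split; apply: eq_bigr => j _.
by rewrite !mxE mulrDl addrA.
Qed.

(** Existence rules out the default value [0] of [xget]. *)
Lemma nash_minimizer_nash (R : realType) (d : nat) (c : costs R d)
    (pi V : 'rV[R]_d) :
  (exists! P : 'M[R]_d, nash_minimizer c pi V P) ->
  nash_minimizer c pi V (nash c pi V).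
Proof. by case=> P [nP _]; apply: (@xgetPex _ 0); exists P. Qed.

Lemma Gmap_le_ecost (R : realType) (d : nat) (c : costs R d)
    (pi V : 'rV[R]_d) (P : 'M[R]_d) (i : 'I_d) :
  row_dependent c -> simplex pi ->
  nash_minimizer c pi V (nash c pi V) -> stochastic P ->
  Gmap c pi V 0 i <= ecost c pi P V i.
Proof.
move=> rowc spi [sN minN] sP; rewrite mxE.
(* The unilateral deviation to row [i] of [P] yields a matrix that shares this row with [P], hence
   has the same [i]-th cost by row dependence. *)
apply: le_trans (minN i (row i P) (sP i)) _.
rewrite (ecost_row R d c pi V _ P) ?row_replace_row //.
exact: replace_row_stochastic.
Qed.

Lemma stationary_dotv_Gmap_le (R : realType) (d : nat) (c : costs R d)
    (pi V V' : 'rV[R]_d) (lambda : R) :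
  row_dependent c -> simplex pi ->
  nash_minimizer c pi V (nash c pi V) ->
  nash_minimizer c pi V' (nash c pi V') ->
  Kmap c V pi = pi -> Gmap c pi V = const_mx lambda + V ->
  dotv pi (Gmap c pi V') <= lambda + dotv pi V'.
Proof.
move=> rowc spi nV nV' KV GV.
have leG i : Gmap c pi V' 0 i
    <= (Gmap c pi V + (V' - V) *m (nash c pi V)^T) 0 i.
  (* The minimizer for [V] competes at [V']. Only the [V'] inside [ecost] is then split as
     [V + (V' - V)]. *)
  have := Gmap_le_ecost R d c pi V' _ i rowc spi nV' nV.1.
  by rewrite -{2}(subrK V V') addrC ecostD !mxE.
apply: le_trans (dotv_simplex_le _ _ _ _ _ spi leG) _.
(* Invariance turns the correction into [dotv pi (V' - V)], whose [V] part cancels the one in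
   [Gmap c pi V]. *)
rewrite dotvDr dotv_mulmx -/(Kmap c V pi) KV GV dotvBr dotvDr.
by rewrite dotv_simplex_const // -addrA subrKC.
Qed.

Theorem proposition7 (R : realType) (d : nat) (hd : (1 < d)%N)
    (nrm : 'rV[R]_d -> R) (hnrm : is_norm nrm) (c : costs R d)
    (hnash : forall pi V : 'rV[R]_d, simplex pi ->
      exists! P : 'M[R]_d, nash_minimizer c pi V P)
    (hrow : row_dependent c)
    (hmono : exists2 gamma : R, 0 < gamma &
      forall V V' pi pi' : 'rV[R]_d, simplex pi -> simplex pi' ->
        gamma * nrm (pi - pi') ^+ 2 <=
          dotv pi' (Gmap c pi' V - Gmap c pi V)
          + dotv pi (Gmap c pi V' - Gmap c pi' V'))
    (pi1 pi2 V1 V2 : 'rV[R]_d) (lambda1 lambda2 : R)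
    (hpi1 : simplex pi1) (hpi2 : simplex pi2)
    (hK1 : Kmap c V1 pi1 = pi1) (hG1 : Gmap c pi1 V1 = const_mx lambda1 + V1)
    (hK2 : Kmap c V2 pi2 = pi2) (hG2 : Gmap c pi2 V2 = const_mx lambda2 + V2) :
  pi1 = pi2.
Proof.
have nashP pi V (spi : simplex pi) :=
  nash_minimizer_nash R d c pi V (hnash pi V spi).
have le1 := stationary_dotv_Gmap_le R d c pi1 V1 V2 lambda1 hrow hpi1
  (nashP _ _ hpi1) (nashP _ _ hpi1) hK1 hG1.
have le2 := stationary_dotv_Gmap_le R d c pi2 V2 V1 lambda2 hrow hpi2
  (nashP _ _ hpi2) (nashP _ _ hpi2) hK2 hG2.
case: hmono => gamma gamma_gt0 /(_ V1 V2 pi1 pi2 hpi1 hpi2).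
rewrite !dotvBr hG1 hG2 !dotvDr !dotv_simplex_const // => mono.
(* By [le2] the [pi2] terms sum to at most [lambda2 - lambda1], and by [le1] the [pi1] terms to at
   most [lambda1 - lambda2]. *)
have nrm2_le0 : gamma * nrm (pi1 - pi2) ^+ 2 <= 0 by lra.
have [_ _ nrm0] := hnrm.
apply/subr0_eq/nrm0/eqP; rewrite -sqrf_eq0 eq_le sqr_ge0 andbT.
by rewrite -(pmulr_rle0 _ gamma_gt0).
Qed.
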